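(* Let $N$ be a unitarily invariant norm on $M_n(\mathbb{C})$, let $A\in M_n(\mathbb{C})$ be positive definite and let $X\in M_n(\mathbb{C})$. Then, for each of the two choices of sign $\pm$ (the same sign being taken on both sides of each inequality), $$w_N\big(A^{t}XA^{1-t}\pm A^{1-t}XA^{t}\big)\le w_N(AX\pm XA)\quad\text{if } t\in[0,1],$$ $$w_N\big(A^{t}XA^{1-t}\pm A^{1-t}XA^{t}\big)\ge w_N(AX\pm XA)\quad\text{if } t\in\mathbb{R}\setminus[0,1].$$
   Context: For a norm $N$ on $M_n(\mathbb{C})$ (the $n\times n$ complex matrices), the generalized numerical radius of $Y\in M_n(\mathbb{C})$ is $w_N(Y)=\sup_{\theta\in\mathbb{R}}N(\mathrm{Re}(e^{i\theta}Y))$, where $\mathrm{Re}(Z)=\frac12(Z+Z^* )$. The norm $N$ is unitarily invariant if $N(UYV)=N(Y)$ for all $Y\in M_n(\mathbb{C})$ and all unitary $U,V\in M_n(\mathbb{C})$. For a positive definite (Hermitian) matrix $A$ and $t\in\mathbb{R}$, $A^t$ is defined by the functional calculus. *)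

(* Defs.v *)
From HB Require Import structures.
From mathcomp Require Import all_boot all_order all_algebra.
From mathcomp Require Import complex.
From mathcomp Require Import classical_sets reals exp trigo.

Set Implicit Arguments.
Unset Strict Implicit.
Unset Printing Implicit Defensive.

Import Order.TTheory GRing.Theory Num.Theory.

Local Open Scope classical_set_scope.
Local Open Scope ring_scope.
Local Open Scope complex_scope.
Local Open Scope sesquilinear_scope.

Section GeneralizedNumericalRadius.
Context {R : realType} {n : nat}.
Implicit Types (N : 'M[R[i]]_n -> R) (A Y Z : 'M[R[i]]_n) (t : R).

Record is_mxnorm N : Prop := IsMxNorm {
  mxnorm_ge0 : forall Y, 0 <= N Y;
  mxnorm_eq0 : forall Y, N Y = 0 -> Y = 0;
  mxnormZ : forall (c : R[i]) Y, N (c *: Y) = Normc.normc c * N Y;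
  mxnormD : forall Y Z, N (Y + Z) <= N Y + N Z }.

Definition unitarily_invariant N : Prop :=
  forall Y U V, U \is unitarymx -> V \is unitarymx -> N (U *m Y *m V) = N Y.

Definition expi (theta : R) : R[i] := cos theta +i* sin theta.

Definition hermitian_part Z : 'M[R[i]]_n := 2^-1 *: (Z + Z ^t*).

(* When N is a norm the set is bounded above, by (N Y + N (Y ^t* )) / 2, so
   that the real supremum is the genuine one. *)
Definition num_radius N Y : R :=
  sup [set N (hermitian_part (expi theta *: Y)) | theta in [set: R]].

Definition posdefmx A : Prop :=
  A \is hermsymmx /\
  forall x : 'cV[R[i]]_n, x != 0 -> 0 < (x ^t* *m A *m x) 0 0.

(* Functional calculus for a Hermitian A and f : R -> R: the spectral theorem
   gives A = U^-1 *m diag_mx d *m U with U := spectralmx A unitary and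
   d := spectral_diag A real, and f(A) = U^-1 *m diag_mx (f d) *m U, which does
   not depend on the chosen diagonalization. *)
Definition mxfun_calc (f : R -> R) A : 'M[R[i]]_n :=
  invmx (spectralmx A)
    *m diag_mx (map_mx (fun z : R[i] => (f (complex.Re z))%:C) (spectral_diag A))
    *m spectralmx A.

Definition mxpowR A t : 'M[R[i]]_n := mxfun_calc (fun x => x `^ t) A.

End GeneralizedNumericalRadius.

(* Main.v *)
(* Write F_s = A^s X A^(1-s) ± A^(1-s) X A^s. The hermitian part of e^(iθ) F_s
   is a matrix of the same form, with another X, so it suffices to compare the
   norms N(F_s). These satisfy F_(1-s) = ± F_s and
     F_(s+r) + F_(s-r) = A^r F_s A^-r + A^-r F_s A^r,
   so the inequality 2 N(Z) <= N(A^r Z A^-r + A^-r Z A^r) makes s |-> N(F_s)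
   midpoint convex; it is also symmetric about 1/2 and locally bounded, hence
   nondecreasing in |s - 1/2|, and F_1 = AX ± XA.

   In an eigenbasis of A that inequality says that entrywise multiplication by
   cosh(x_i - x_j), x real, does not decrease N. Multipliers with this property
   are closed under products and limits. They contain 1 + i (x_i - x_j), because
   Z |-> i [H, Z] generates a group of isometries when H is real diagonal; hence
   also Q(x_i - x_j) for every polynomial Q with Q(0) = 1 and purely imaginary
   roots, such as ((1 + u/m)^m + (1 - u/m)^m) / 2, which tends to cosh u. *)
Require Import Defs.
From mathcomp Require Import all_boot all_order all_algebra.
From mathcomp Require Import complex.
From mathcomp Require Import classical_sets reals sequences exp trigo.
From mathcomp Require Import ring lra.

Set Implicit Arguments.
Unset Strict Implicit.
Unset Printing Implicit Defensive.

Import Order.TTheory GRing.Theory Num.Theory Normc.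

Local Open Scope complex_scope.
Local Open Scope sesquilinear_scope.
Local Open Scope ring_scope.

Section ComplexModulus.
Context {R : realType}.
Implicit Types (a b : R) (z w : R[i]).

Lemma normrcE z : `|z| = (normc z)%:C. Proof. by []. Qed.

Lemma normc_ge0 z : 0 <= normc z.
Proof. by rewrite -ler0c -normrcE normr_ge0. Qed.

Lemma normc_real a : normc a%:C = `|a|.
Proof. by rewrite /= expr0n addr0 sqrtr_sqr. Qed.

Lemma normc_le_ReIm a b : normc (a +i* b) <= `|a| + `|b|.
Proof.
rewrite -[leRHS]ger0_norm ?addr_ge0// -sqrtr_sqr ler_wsqrtr// sqrrD.
by rewrite !real_normK ?num_real// [leRHS]addrAC lerDl mulrn_wge0// mulr_ge0.
Qed.

Lemma normc_ge_Re a b : `|a| <= normc (a +i* b).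
Proof. by rewrite -sqrtr_sqr ler_wsqrtr// lerDl sqr_ge0. Qed.

Lemma conj_complexE a b : (a +i* b)^* = a -i* b. Proof. by []. Qed.

End ComplexModulus.

Section ExponentialLimit.
Context {R : realType}.
Implicit Types (u y : R) (m : nat).

Lemma bernoulli_le y m : 0 <= y <= 1 -> 1 - m%:R * y <= (1 - y) ^+ m.
Proof.
case/andP=> y0 y1; elim: m => [|m IH]; first by rewrite mul0r subr0 expr0.
rewrite exprS -natr1.
have m0 : 0 <= m%:R :> R by [].
have : (1 - y) * (1 - m%:R * y) <= (1 - y) * (1 - y) ^+ m.
  by rewrite ler_wpM2l// subr_ge0.
have := mulr_ge0 m0 (mulr_ge0 y0 y0); nra.
Qed.

Lemma compound_le_expR u m : (0 < m)%N -> `|u| <= m%:R ->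
  0 <= (1 + u / m%:R) ^+ m <= expR u.
Proof.
move=> m_gt0; rewrite ler_norml => /andP[u1 u2].
have m0 : 0 < m%:R :> R by rewrite ltr0n.
have h0 : 0 <= 1 + u / m%:R.
  by rewrite -(ler_pM2r m0) mul0r mulrDl divfK ?gt_eqF// mul1r -lerBlDl sub0r.
rewrite exprn_ge0//= (_ : expR u = expR (u / m%:R) ^+ m).
  by rewrite lerXn2r ?nnegrE ?expR_ge0// expR_ge1Dx.
by rewrite -expRM_natr divfK ?gt_eqF.
Qed.

Lemma compound_expR u m : (0 < m)%N -> `|u| <= m%:R ->
  `|(1 + u / m%:R) ^+ m - expR u| <= expR u * u ^+ 2 / m%:R.
Proof.
move=> m_gt0 um; have m0 : 0 < m%:R :> R by rewrite ltr0n.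
have /andP[p0 p1] := compound_le_expR m_gt0 um.
have Nu_m : `|- u| <= m%:R by rewrite normrN.
have /andP[n0 n1] := compound_le_expR m_gt0 Nu_m.
rewrite distrC ger0_norm ?subr_ge0//.
have y01 : 0 <= (u / m%:R) ^+ 2 <= 1.
  rewrite sqr_ge0 -real_normK ?num_real// expr_le1// normrM normfV.
  by rewrite [X in _ / X]ger0_norm// ler_pdivrMr// mul1r.
have := bernoulli_le m y01.
rewrite (_ : 1 - (u / m%:R) ^+ 2 = (1 + u / m%:R) * (1 + - u / m%:R)); last first.
  by rewrite mulNr; ring.
rewrite exprMn (_ : m%:R * _ = u ^+ 2 / m%:R); last by field; rewrite gt_eqF.
move=> /(ler_wpM2l (expR_ge0 u)).
have := ler_wpM2l p0 n1; rewrite expRN => /(ler_wpM2l (expR_ge0 u)).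
rewrite [X in _ <= X](_ : _ = (1 + u / m%:R) ^+ m) => [h1 h2|]; last first.
  by rewrite mulrCA divff ?mulr1 ?gt_eqF ?expR_gt0.
rewrite exprMn in h2.
by have := le_trans h2 h1; rewrite mulrBr mulr1 mulrA; lra.
Qed.

End ExponentialLimit.

Section UnitarilyInvariantNorm.
Context {R : realType} {n : nat} (N : 'M[R[i]]_n -> R).
Hypotheses (normN : is_mxnorm N) (unitN : unitarily_invariant N).
Implicit Types (Y Z : 'M[R[i]]_n) (K L : 'I_n -> 'I_n -> R[i]).

Let mxnorm_ge0 Y : 0 <= N Y. Proof. exact: (mxnorm_ge0 normN). Qed.
Let mxnormZ c Y : N (c *: Y) = normc c * N Y.
Proof. exact: (mxnormZ normN). Qed.
Let mxnormD Y Z : N (Y + Z) <= N Y + N Z. Proof. exact: (mxnormD normN). Qed.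

Lemma mxnorm0 : N 0 = 0.
Proof. by rewrite -(scale0r 0) mxnormZ normc0 mul0r. Qed.

Lemma mxnormZr a Y : N (a%:C *: Y) = `|a| * N Y.
Proof. by rewrite mxnormZ normc_real. Qed.

Lemma mxnormN Y : N (- Y) = N Y.
Proof. by rewrite -scaleN1r -(rmorphN1 (real_complex R)) mxnormZr normrN1 mul1r. Qed.

Lemma mxnorm_sum I (r : seq I) (P : pred I) (F : I -> 'M[R[i]]_n) :
  N (\sum_(i <- r | P i) F i) <= \sum_(i <- r | P i) N (F i).
Proof.
elim/big_ind2: _ => [|x y z t xy zt|//]; first by rewrite mxnorm0.
exact: le_trans (mxnormD _ _) (lerD xy zt).
Qed.

Lemma mxnorm_le_entries Y :
  N Y <= \sum_i \sum_j normc (Y i j) * N (delta_mx i j).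
Proof.
rewrite [X in N X]matrix_sum_delta.
apply: le_trans (mxnorm_sum _ _ _) _; apply: ler_sum => i _.
apply: le_trans (mxnorm_sum _ _ _) _; apply: ler_sum => j _.
by rewrite mxnormZ.
Qed.

Definition schur K Y : 'M[R[i]]_n := \matrix_(i, j) (K i j * Y i j).

Definition expansive K := forall Y, N Y <= N (schur K Y).

Lemma expansive_ext K L : (forall i j, K i j = L i j) -> expansive K -> expansive L.
Proof.
move=> KL eK Y; suff -> : schur L Y = schur K Y by [].
by apply/matrixP => i j; rewrite !mxE KL.
Qed.

Lemma expansive1 : expansive (fun _ _ => 1).
Proof.
move=> Y; suff -> : schur (fun _ _ => 1) Y = Y by [].
by apply/matrixP => i j; rewrite mxE mul1r.
Qed.

Lemma expansiveM K L : expansive K -> expansive L ->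
  expansive (fun i j => K i j * L i j).
Proof.
move=> eK eL Y; apply: le_trans (eL Y) _; apply: le_trans (eK _) _.
rewrite le_eqVlt; apply/orP; left; apply/eqP; congr N.
by apply/matrixP => i j; rewrite !mxE mulrA.
Qed.

Lemma expansive_prod (I : eqType) (r : seq I) (F : I -> 'I_n -> 'I_n -> R[i]) :
  (forall k, k \in r -> expansive (F k)) ->
  expansive (fun i j => \prod_(k <- r) F k i j).
Proof.
elim: r => [_|k r IH eF].
  by apply: expansive_ext expansive1 => i j; rewrite big_nil.
have eFr := IH (fun l lr => eF l (mem_behead (s := k :: r) lr)).
by apply: expansive_ext (expansiveM (eF k (mem_head _ _)) eFr) => i j; rewrite big_cons.
Qed.

Lemma expansive_lim K :
  (forall e : R, 0 < e ->
     exists2 L, expansive L & forall i j, normc (L i j - K i j) <= e) ->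
  expansive K.
Proof.
move=> limK Y.
pose c : R := 1 + \sum_i \sum_j normc (Y i j) * N (delta_mx i j).
have c_gt0 : 0 < c.
  rewrite ltr_wpDr// sumr_ge0// => i _; rewrite sumr_ge0// => j _.
  by rewrite mulr_ge0 ?normc_ge0.
apply/ler_addgt0Pr => e e_gt0.
have [L eL LK] := limK (e / c) (divr_gt0 e_gt0 c_gt0).
have -> : e = (e / c) * c by rewrite divfK ?gt_eqF.
have LE : schur L Y = schur K Y + schur (fun i j => L i j - K i j) Y.
  by apply/matrixP => i j; rewrite !mxE mulrBl addrC subrK.
apply: le_trans (eL Y) _; rewrite LE; apply: le_trans (mxnormD _ _) _.
rewrite lerD2l; apply: le_trans (mxnorm_le_entries _) _.
rewrite mulrDr mulr1 ler_wpDl ?(ltW (divr_gt0 _ _))// mulr_sumr.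
apply: ler_sum => i _; rewrite mulr_sumr; apply: ler_sum => j _.
by rewrite mulrA ler_wpM2r// mxE normcM ler_wpM2r ?normc_ge0.
Qed.

Lemma diag_unitary (v : 'I_n -> R[i]) :
  (forall i, v i * (v i)^* = 1) -> diag_mx (\row_i v i) \is unitarymx.
Proof.
move=> v1; apply/unitarymxP; rewrite tr_diag_mx map_diag_mx mulmx_diag.
apply/matrixP => i j; rewrite !mxE; case: eqP => [->|]//=.
by rewrite v1.
Qed.

(* [schur K Y] is [(1 + mu) Y - mu D Y D^*] for a diagonal unitary [D]. *)
Lemma expansive_unitary (v : 'I_n -> R[i]) (mu : R) :
  (forall i, v i * (v i)^* = 1) -> 0 <= mu ->
  expansive (fun i j => 1 - mu%:C * (v i * (v j)^* - 1)).
Proof.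
move=> v1 mu_ge0 Y; set K := fun i j => _.
pose D := diag_mx (\row_i v i); have uD : D \is unitarymx by exact: diag_unitary.
have DE : (1 + mu)%:C *: Y = schur K Y + mu%:C *: (D *m Y *m D ^t*).
  apply/matrixP => i j; rewrite /D tr_diag_mx map_diag_mx mul_diag_mx mul_mx_diag.
  by rewrite !mxE rmorphD /= /K; ring.
have := mxnormD (schur K Y) (mu%:C *: (D *m Y *m D ^t*)).
rewrite -DE !mxnormZr unitN ?trmxC_unitary// !ger0_norm ?addr_ge0//.
by rewrite mulrDl mul1r lerD2r.
Qed.

(* The limit d -> 0 of [expansive_unitary] for the Cayley transform [v] of
   [d y] and mu = 1 / (2 d): the commutator with [diag y] is the derivative of
   the conjugation by [diag v]. *)
Lemma expansive_linear (y : 'I_n -> R) :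
  expansive (fun i j => 1 + 'i%C * (y i - y j)%:C).
Proof.
apply: expansive_lim => e e_gt0.
pose c : R := 1 + \sum_i `|y i|.
have c_ge1 : 1 <= c by rewrite lerDl sumr_ge0.
have yc i : `|y i| <= c.
  by rewrite /c (bigD1 i)//= addrCA lerDl addr_ge0// sumr_ge0.
have c3_gt0 : 0 < 6 * c ^+ 3 by rewrite mulr_gt0// exprn_gt0// (lt_le_trans _ c_ge1).
pose d : R := e / (6 * c ^+ 3 + e).
have d_gt0 : 0 < d by rewrite divr_gt0// addr_gt0.
have d_le1 : d <= 1 by rewrite ler_pdivrMr ?addr_gt0// mul1r lerDr ltW.
have dc : 6 * c ^+ 3 * d <= e.
  by rewrite mulrA ler_pdivrMr ?addr_gt0// mulrC ler_pM2l// lerDl ltW.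
pose p i : R[i] := 1 +i* (d * y i).
have p_neq0 i : p i != 0 by rewrite eq_complex /= oner_eq0.
have pJ_neq0 i : (p i)^* != 0 by rewrite conjC_eq0.
pose v i := (p i)^* / p i.
have v1 i : v i * (v i)^* = 1.
  rewrite /v rmorphM fmorphV /= conjCK.
  by field; rewrite p_neq0 pJ_neq0.
exists (fun i j => 1 - ((2 * d)^-1)%:C * (v i * (v j)^* - 1)).
  by apply: expansive_unitary => //; rewrite invr_ge0 mulr_ge0// ltW.
move=> i j; pose w := p i * (p j)^*.
have nw : 1 <= normc w.
  have np k : 1 <= normc (p k) by apply: le_trans (normc_ge_Re _ _); rewrite normr1.
  have npJ k : 1 <= normc (p k)^* by apply: le_trans (normc_ge_Re _ _); rewrite normr1.
  by rewrite normcM -[1]mulr1 ler_pM.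
have wE : 1 - w = - (d ^+ 2 * (y i * y j)) +i* (d * (y j - y i)).
  by rewrite /w /p conj_complexE -[X in X - _]/(1 +i* 0); simpc; congr (_ +i* _); ring.
have vE : v i * (v j)^* - 1 = (2 * d)%:C * (y j - y i)%:C * 'i%C / w.
  rewrite /v rmorphM fmorphV /= conjCK /w.
  apply: (mulIf (x := p i * (p j)^*)); first by rewrite mulf_neq0.
  rewrite [RHS]divfK ?mulf_neq0//.
  transitivity ((p i)^* * p j - p i * (p j)^*).
    by field; rewrite p_neq0 pJ_neq0.
  by rewrite /p !conj_complexE; simpc; congr (_ +i* _); ring.
have -> : 1 - ((2 * d)^-1)%:C * (v i * (v j)^* - 1) - (1 + 'i%C * (y i - y j)%:C)
    = (y i - y j)%:C * 'i%C * (1 - w) / w.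
  rewrite vE fmorphV [(y j - y i)%:C](_ : _ = - (y i - y j)%:C); last first.
    by rewrite -rmorphN opprB.
  by field; rewrite mulf_neq0//= fmorph_eq0 gt_eqF.
rewrite !normcM normcV normc_real.
have -> : normc 'i%C = 1 :> R by rewrite /= expr0n expr1n add0r sqrtr1.
rewrite mulr1; apply: le_trans dc.
have yij : `|y i - y j| <= 2 * c.
  by rewrite mulr_natl mulr2n; apply: le_trans (ler_normB _ _) (lerD _ _).
have n1w : normc (1 - w) <= 3 * c ^+ 2 * d.
  have d2 : d ^+ 2 <= d by rewrite expr2 ger_pMl.
  have b1 : `|- (d ^+ 2 * (y i * y j))| <= d * (c * c).
    rewrite normrN normrM [`|y i * _|]normrM ger0_norm ?sqr_ge0//.
    by rewrite ler_pM ?sqr_ge0 ?mulr_ge0// ler_pM.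
  have b2 : `|d * (y j - y i)| <= d * (2 * c ^+ 2).
    rewrite normrM (ger0_norm (ltW d_gt0)) ler_pM2l// distrC.
    by apply: le_trans yij _; rewrite ler_pM2l// ler_eXnr.
  have -> : 3 * c ^+ 2 * d = d * (c * c) + d * (2 * c ^+ 2) by ring.
  by rewrite wE; apply: le_trans (normc_le_ReIm _ _) (lerD b1 b2).
apply: (@le_trans _ _ (`|y i - y j| * normc (1 - w))).
  rewrite ler_piMr ?mulr_ge0 ?normc_ge0// invf_le1// (lt_le_trans _ nw)//.
rewrite (_ : 6 * c ^+ 3 * d = (2 * c) * (3 * c ^+ 2 * d)); last by ring.
by rewrite ler_pM ?normc_ge0.
Qed.

(* A root [i c] contributes the factor [1 + i u / c], which is expansive. *)
Lemma expansive_poly (Q : {poly R[i]}) (x : 'I_n -> R) :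
  Q.[0] = 1 -> (forall z, root Q z -> complex.Re z = 0) ->
  expansive (fun i j => Q.[(x i - x j)%:C]).
Proof.
move=> Q0 Qim; have [r Qr] := closed_field_poly_normal Q.
have QE z : Q.[z] = lead_coef Q * \prod_(w <- r) (z - w).
  rewrite [in LHS]Qr hornerZ horner_prod; congr (_ * _).
  by apply: eq_bigr => w _; rewrite hornerXsubC.
have Q_neq0 : lead_coef Q != 0.
  by apply/eqP => l0; have := QE 0; rewrite Q0 l0 mul0r => /eqP; rewrite oner_eq0.
have rootr w : w \in r -> root Q w.
  by move=> wr; rewrite Qr rootZ// root_prod_XsubC.
have r_neq0 w : w \in r -> w != 0.
  move=> /rootr; apply: contraTneq => ->.
  by rewrite rootE Q0 oner_eq0.
apply: (@expansive_ext (fun i j => \prod_(w <- r) (1 - (x i - x j)%:C / w))).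
  move=> i j; rewrite QE; have := QE 0; rewrite Q0 => Q1.
  have -> : \prod_(w <- r) ((x i - x j)%:C - w) =
      \prod_(w <- r) (0 - w) * \prod_(w <- r) (1 - (x i - x j)%:C / w).
    rewrite -big_split /= big_seq [RHS]big_seq; apply: eq_bigr => w /r_neq0 w0.
    by field.
  by rewrite mulrA -Q1 mul1r.
apply: expansive_prod => w wr.
have wE : w = 'i%C * (complex.Im w)%:C.
  by rewrite [LHS]complexE (Qim _ (rootr _ wr)) add0r.
have i2 : 'i%C * 'i%C = -1 :> R[i] by rewrite -expr2 sqr_i.
have w0 := r_neq0 _ wr; rewrite wE mulf_eq0 negb_or in w0.
have /andP[i0 c0] := w0.
apply: expansive_ext (expansive_linear (fun i => x i / complex.Im w)) => i j /=.
rewrite -mulrBl rmorphM fmorphV [in RHS]wE invfM.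
rewrite (_ : 'i%C^-1 = - 'i%C) /=; last first.
  by apply: (mulfI i0); rewrite mulfV// mulrN i2 opprK.
ring.
Qed.

Definition compound_cosh m : {poly R[i]} :=
  2^-1 *: ((1 + m%:R^-1 *: 'X) ^+ m + (1 - m%:R^-1 *: 'X) ^+ m).

Lemma compound_coshE m (u : R) : (compound_cosh m).[u%:C] =
  (((1 + u / m%:R) ^+ m + (1 + - u / m%:R) ^+ m) / 2)%:C.
Proof.
rewrite /compound_cosh !hornerE mulrC !rmorphM rmorphD !rmorphXn !rmorphD.
rewrite !rmorphM !fmorphV rmorphN !rmorph_nat rmorph1 /=.
by rewrite mulNr ![_^-1 * u%:C]mulrC.
Qed.

Lemma root_compound_cosh m z : (0 < m)%N -> root (compound_cosh m) z ->
  complex.Re z = 0.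
Proof.
move=> m0; rewrite rootE !hornerE mulf_eq0 invr_eq0 pnatr_eq0 /= addr_eq0.
move=> /eqP /(congr1 Num.norm); rewrite normrN !normrX => /eqP.
rewrite eqrXn2// => /eqP.
have -> : m%:R^-1 = (m%:R^-1)%:C :> R[i] by rewrite fmorphV rmorph_nat.
case: z => a b; simpc; move=> /= [] /(congr1 (fun y => y ^+ 2)).
rewrite !sqr_sqrtr ?addr_ge0 ?sqr_ge0// sqrrN => h.
have : m%:R^-1 * a = 0 by lra.
by move/eqP; rewrite mulf_eq0 invr_eq0 pnatr_eq0 -[m == 0%N]negbK -lt0n m0 => /eqP.
Qed.

Lemma expansive_cosh (x : 'I_n -> R) :
  expansive (fun i j => ((expR (x i - x j) + expR (x j - x i)) / 2)%:C).
Proof.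
apply: expansive_lim => e e_gt0.
pose c : R := \sum_i `|x i| + \sum_i `|x i|.
have c0 : 0 <= c by rewrite addr_ge0// sumr_ge0.
have xc i j : `|x i - x j| <= c.
  apply: le_trans (ler_normB _ _) _; rewrite lerD//.
    by rewrite (bigD1 i)//= lerDl sumr_ge0.
  by rewrite (bigD1 j)//= lerDl sumr_ge0.
pose b : R := c + expR c * c ^+ 2 / e.
have ec0 : 0 <= expR c * c ^+ 2 by rewrite mulr_ge0 ?expR_ge0 ?sqr_ge0.
have b0 : 0 <= b by rewrite addr_ge0// divr_ge0// ltW.
pose m := (Num.bound b).+1.
have bm : b <= m%:R by rewrite (le_trans (ltW (archi_boundP b0)))// ler_nat.
have m_gt0 : 0 < m%:R :> R by rewrite ltr0n.
have cm : c <= m%:R by apply: le_trans bm; rewrite lerDl divr_ge0// ltW.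
have em : expR c * c ^+ 2 / m%:R <= e.
  rewrite ler_pdivrMr// [e * _]mulrC -ler_pdivrMr//; apply: le_trans bm.
  by rewrite lerDr.
exists (fun i j => (compound_cosh m).[(x i - x j)%:C]).
  apply: expansive_poly => [|z]; last exact: root_compound_cosh.
  rewrite -[0]/((0 : R)%:C) compound_coshE oppr0 !mul0r addr0 expr1n.
  by congr (_ %:C); lra.
have err i j : `|(1 + (x i - x j) / m%:R) ^+ m - expR (x i - x j)| <= e.
  have xm : `|x i - x j| <= m%:R := le_trans (xc i j) cm.
  apply: le_trans em; apply: (le_trans (compound_expR (ltn0Sn _) xm)).
  rewrite ler_wpM2r ?invr_ge0// ler_pM ?expR_ge0 ?sqr_ge0 ?ler_expR//.
    exact: le_trans (ler_norm _) (xc _ _).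
  by rewrite -real_normK ?num_real// lerXn2r ?nnegrE.
move=> i j; rewrite compound_coshE -rmorphB normc_real opprB.
rewrite -mulrBl opprD addrACA normrM normfV normr_nat ler_pdivrMr// mulr_natr mulr2n.
by apply: le_trans (ler_normD _ _) (lerD (err _ _) (err _ _)).
Qed.

End UnitarilyInvariantNorm.

Section MidpointConvexity.
Context {R : realType}.
Local Open Scope classical_set_scope.

(* With S the supremum of h on [-|y|, |y|], midpoint convexity between |y| and
   2 a - |y| gives h a <= (h y + S) / 2 for 0 <= a <= |y|, hence S <= h y:
   local boundedness replaces continuity. *)
Lemma even_midpoint_convex_le (h : R -> R) :
  (forall x r, 2 * h x <= h (x + r) + h (x - r)) -> (forall x, h (- x) = h x) ->
  (forall y, exists M, forall x, `|x| <= y -> h x <= M) ->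
  forall x y, `|x| <= `|y| -> h x <= h y.
Proof.
move=> hmid hN hbnd x0 y x0y; have [M hM] := hbnd `|y|.
have habs x : h `|x| = h x by case: (ger0P x).
pose S := [set h x | x in [set x | `|x| <= `|y|]].
have Sub : has_ubound S by exists M => _ [x xy <-]; exact: hM.
have Sh x : `|x| <= `|y| -> h x <= sup S.
  by move=> xy; apply: ub_le_sup => //; exists x.
have key (a b : R) : b = `|y| -> 0 <= a -> a <= b -> h a <= (h y + sup S) / 2.
  move=> bE a0 ab; have := hmid a (b - a).
  have -> : a + (b - a) = b by ring.
  have : h (a - (b - a)) <= sup S by apply: Sh; rewrite -bE ler_norml; lra.
  have : h b = h y by rewrite bE habs.
  lra.
suff : sup S <= (h y + sup S) / 2 by have := Sh _ x0y; lra.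
apply: ge_sup; first by exists (h x0), x0.
by move=> _ [x xy <-]; rewrite -habs (key _ `|y|).
Qed.

End MidpointConvexity.

Lemma posdef_diag_gt0 (R : realType) n (U : 'M[R[i]]_n) (d : 'rV[R[i]]_n) i :
  U \is unitarymx -> posdefmx (U ^t* *m diag_mx d *m U) -> 0 < d 0 i.
Proof.
move=> /unitarymxP UUt [_ pos].
have [x Ux] : exists x : 'cV[R[i]]_n, U *m x = delta_mx i 0.
  by exists (U ^t* *m delta_mx i 0); rewrite mulmxA UUt mul1mx.
have x0 : x != 0.
  apply/eqP => x0; move: Ux; rewrite x0 mulmx0 => /matrixP /(_ i 0).
  by rewrite !mxE !eqxx => /eqP; rewrite eq_sym oner_eq0.
have := pos x x0.
have -> : x ^t* *m (U ^t* *m diag_mx d *m U) *m x =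
    (U *m x) ^t* *m diag_mx d *m (U *m x).
  by rewrite trmx_mul map_mxM !mulmxA.
rewrite Ux trmx_delta map_delta_mx -rowE row_diag_mx.
by rewrite -scalemxAl mul_delta_mx !mxE !eqxx mulr1.
Qed.

Section NumRadius.
Context {R : realType} {n : nat} (N : 'M[R[i]]_n -> R).
Hypothesis normN : is_mxnorm N.
Local Open Scope classical_set_scope.

Lemma num_radius_le (Y Z : 'M[R[i]]_n) :
  (forall theta, N (hermitian_part (expi theta *: Y)) <=
                 N (hermitian_part (expi theta *: Z))) ->
  num_radius N Y <= num_radius N Z.
Proof.
move=> YZ; apply: ge_sup; first by exists (N (hermitian_part (expi 0 *: Y))), 0.
move=> _ [theta _ <-]; apply: le_trans (YZ theta) _.
apply: ub_le_sup; last by exists theta.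
exists ((N Z + N (Z ^t*)) / 2) => _ [eta _ <-].
have n2 : normc (2^-1 : R[i]) = 2^-1.
  have -> : 2^-1 = (2^-1)%:C :> R[i] by rewrite fmorphV rmorph_nat.
  by rewrite normc_real ger0_norm ?invr_ge0.
have ne : normc (expi eta) = 1 :> R by rewrite /= cos2Dsin2 sqrtr1.
have neJ : normc (expi eta)^* = 1 :> R by rewrite /= sqrrN cos2Dsin2 sqrtr1.
rewrite /hermitian_part (mxnormZ normN) n2 mulrC ler_wpM2r ?invr_ge0//.
apply: le_trans (mxnormD normN _ _) _; rewrite (mxnormZ normN) ne mul1r lerD2l.
have -> : (expi eta *: Z) ^t* = (expi eta)^* *: Z ^t*.
  by apply/matrixP => i j; rewrite !mxE rmorphM.
by rewrite (mxnormZ normN) neJ mul1r.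
Qed.

End NumRadius.

Section HeinzMeans.
Context {R : numFieldType} {C : numClosedFieldType} {n : nat} (G : R -> 'M[C]_n).
Hypotheses (GD : forall s t, G s *m G t = G (s + t))
  (G_adj : forall t, (G t) ^t* = G t).
Implicit Types (W X Y Z : 'M[C]_n) (s t r : R) (b : bool).

Definition heinz b W t : 'M[C]_n :=
  G t *m W *m G (1 - t) + (-1) ^+ b *: (G (1 - t) *m W *m G t).

Lemma heinz_reflect b W t : heinz b W (1 - t) = (-1) ^+ b *: heinz b W t.
Proof.
rewrite /heinz scalerDr scalerA -signr_addb addbb scale1r addrC.
by have -> : 1 - (1 - t) = t by ring.
Qed.

Lemma heinz_midpoint b W t r :
  G r *m heinz b W t *m G (- r) + G (- r) *m heinz b W t *m G r =
  heinz b W (t + r) + heinz b W (t - r).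
Proof.
have powers s s' u u' :
    G s *m (G u *m W *m G u') *m G s' = G (s + u) *m W *m G (u' + s').
  by rewrite !mulmxA GD -!mulmxA GD.
rewrite /heinz !mulmxDr !mulmxDl -!scalemxAr -!scalemxAl !powers.
have -> : r + t = t + r by ring.
have -> : - r + t = t - r by ring.
have -> : 1 - t - r = 1 - (t + r) by ring.
have -> : 1 - t + r = 1 - (t - r) by ring.
have -> : r + (1 - t) = 1 - (t - r) by ring.
have -> : - r + (1 - t) = 1 - (t + r) by ring.
rewrite -!addrA; congr (_ + _); rewrite addrCA [RHS]addrCA; congr (_ + _).
by rewrite addrC.
Qed.

Lemma heinz_hermitian_part b X t (c : C) :
  2^-1 *: (c *: heinz b X t + (c *: heinz b X t) ^t*) =
  heinz b (2^-1 *: (c *: X + ((-1) ^+ b * c^*) *: X ^t*)) t.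
Proof.
have adjZ (z : C) Z : (z *: Z) ^t* = z^* *: Z ^t*.
  by apply/matrixP => i j; rewrite !mxE rmorphM.
have adjM s u : (G s *m X *m G u) ^t* = G u *m X ^t* *m G s.
  by rewrite !trmx_mul !map_mxM !G_adj mulmxA.
have adjD Y Z : (Y + Z) ^t* = Y ^t* + Z ^t* by rewrite linearD map_mxD.
rewrite /heinz -!scalemxAr -!scalemxAl !mulmxDr !mulmxDl.
rewrite -!scalemxAr -!scalemxAl adjZ adjD adjZ !adjM rmorph_sign.
have sg2 : (-1) ^+ b * (-1) ^+ b = 1 :> C by rewrite -signr_addb addbb.
move: ((-1) ^+ b) sg2 => e e2.
set p := G t *m X *m _; set q := _ *m X *m G t.
set p' := _ *m X ^t* *m G t; set q' := G t *m X ^t* *m _.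
move: p q p' q' => p q p' q'; apply/matrixP => i j; rewrite !mxE.
have -> : e * (2^-1 * (c * q i j + e * c^* * p' i j)) =
    2^-1 * (e * c * q i j + (e * e) * c^* * p' i j) by ring.
by rewrite e2; ring.
Qed.

End HeinzMeans.

Section ExponentialGroup.
Context {R : realType} {n : nat} (U : 'M[R[i]]_n) (L : 'I_n -> R).
Hypothesis U_unitary : U \is unitarymx.
Implicit Types (W X Y Z : 'M[R[i]]_n) (s t r : R).

Let UUt : U *m U ^t* = 1%:M. Proof. exact/unitarymxP. Qed.
Let UtU : U ^t* *m U = 1%:M.
Proof. by rewrite -invmx_unitary// mulVmx// unitarymx_unit. Qed.
Let Ut_unitary : U ^t* \is unitarymx. Proof. by rewrite trmxC_unitary. Qed.

Definition exp_diag t : 'M[R[i]]_n := diag_mx (\row_i (expR (t * L i))%:C).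

(* B^t for B = U^* exp(L) U. *)
Definition exp_mx t : 'M[R[i]]_n := U ^t* *m exp_diag t *m U.
Local Notation P := exp_mx.

Lemma exp_diagD s t : exp_diag s *m exp_diag t = exp_diag (s + t).
Proof.
rewrite mulmx_diag; congr diag_mx; apply/matrixP => i j.
by rewrite !mxE mulrDl expRD rmorphM.
Qed.

Lemma exp_mxD s t : P s *m P t = P (s + t).
Proof.
rewrite /exp_mx -(exp_diagD s t).
have -> (V D E W : 'M[R[i]]_n) : V *m D *m W *m (V *m E *m W) =
    V *m D *m (W *m V) *m E *m W by rewrite !mulmxA.
by rewrite UUt mulmx1 !mulmxA.
Qed.

Lemma exp_mx0 : P 0 = 1%:M.
Proof.
rewrite /exp_mx (_ : exp_diag 0 = 1%:M) ?mulmx1//.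
by apply/matrixP => i j; rewrite !mxE mul0r expR0; case: eqP.
Qed.

Lemma exp_mx_adj t : (P t) ^t* = P t.
Proof.
rewrite /exp_mx !trmx_mul !map_mxM trmxCK mulmxA; congr (_ *m _ *m _).
rewrite tr_diag_mx map_diag_mx; congr diag_mx; apply/matrixP => i j.
by rewrite !mxE; exact: conjc_real.
Qed.

Lemma exp_mx_sandwich s t Z : U *m (P s *m Z *m P t) *m U ^t* =
  exp_diag s *m (U *m Z *m U ^t*) *m exp_diag t.
Proof.
by rewrite /exp_mx !mulmxA UUt mul1mx -[_ *m U *m U ^t*]mulmxA UUt mulmx1.
Qed.

Lemma exp_diag_sandwich s t Z i j : (exp_diag s *m Z *m exp_diag t) i j =
  (expR (s * L i) * expR (t * L j))%:C * Z i j.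
Proof. by rewrite mul_mx_diag mul_diag_mx !mxE rmorphM /= mulrAC. Qed.

Context (N : 'M[R[i]]_n -> R).
Hypotheses (normN : is_mxnorm N) (unitN : unitarily_invariant N).

Lemma mxnorm_mean_ge Z r :
  2 * N Z <= N (P r *m Z *m P (- r) +
                P (- r) *m Z *m P r).
Proof.
set S := _ + _.
rewrite -(unitN Z U_unitary Ut_unitary) -(unitN S U_unitary Ut_unitary).
have -> : U *m S *m U ^t* =
    exp_diag r *m (U *m Z *m U ^t*) *m exp_diag (- r) +
    exp_diag (- r) *m (U *m Z *m U ^t*) *m exp_diag r.
  rewrite -(exp_mx_sandwich r (- r) Z) -(exp_mx_sandwich (- r) r Z).
  by rewrite -mulmxDl -mulmxDr.
set Y := U *m Z *m _.
have -> : exp_diag r *m Y *m exp_diag (- r) +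
    exp_diag (- r) *m Y *m exp_diag r =
    2%:C *: schur (fun i j => ((expR (r * L i - r * L j) +
                                expR (r * L j - r * L i)) / 2)%:C) Y.
  apply/matrixP => i j; rewrite [LHS]mxE !exp_diag_sandwich !mxE.
  rewrite -mulrDl [RHS]mulrA -rmorphD -[_%:C * _%:C]rmorphM; congr (_%:C * _).
  by rewrite [RHS]mulrC divfK ?pnatr_eq0// !mulNr !expRD; ring.
rewrite (mxnormZr normN) normr_nat ler_pM2l//.
exact: (expansive_cosh normN unitN (fun i => r * L i)).
Qed.

Lemma exp_mx_sandwich_bounded (T : R) Z : exists M, forall s t,
  `|s| <= T -> `|t| <= T -> N (P s *m Z *m P t) <= M.
Proof.
set Y := U *m Z *m U ^t*.
exists (\sum_i \sum_j (expR (T * `|L i|) * expR (T * `|L j|) * normc (Y i j))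
          * N (delta_mx i j)) => s t sT tT.
rewrite -(unitN _ U_unitary Ut_unitary) exp_mx_sandwich -/Y.
apply: le_trans (mxnorm_le_entries normN _) _.
have expT u i : `|u| <= T -> expR (u * L i) <= expR (T * `|L i|).
  move=> uT; rewrite ler_expR; apply: le_trans (ler_norm _) _.
  by rewrite normrM ler_wpM2r.
apply: ler_sum => i _; apply: ler_sum => j _.
rewrite ler_wpM2r ?(mxnorm_ge0 normN)// exp_diag_sandwich normcM normc_real.
rewrite ler_wpM2r ?normc_ge0// ger0_norm ?mulr_ge0 ?expR_ge0//.
by rewrite ler_pM ?expR_ge0 ?expT.
Qed.

Lemma mxnorm_sign (b : bool) Z : N ((-1) ^+ b *: Z) = N Z.
Proof. by case: b; rewrite ?expr1 ?expr0 ?scaleN1r ?scale1r ?(mxnormN normN). Qed.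

Lemma mxnorm_heinz_bounded b W y : exists M, forall x, `|x| <= y ->
  N (heinz P b W (2^-1 + x)) <= M.
Proof.
have [M MP] := exp_mx_sandwich_bounded (1 + y) W.
exists (M + M) => x xy; have xp s : `|s| <= `|x| -> `|2^-1 + s| <= 1 + y.
  move=> sx; apply: le_trans (ler_normD _ _) _.
  by rewrite lerD ?(le_trans sx)// ger0_norm; lra.
rewrite /heinz; have -> : 1 - (2^-1 + x) = 2^-1 - x by lra.
apply: le_trans (mxnormD normN _ _) _; rewrite mxnorm_sign.
by rewrite lerD// MP// xp// normrN.
Qed.

Lemma mxnorm_heinz_le b W s t : `|s - 2^-1| <= `|t - 2^-1| ->
  N (heinz P b W s) <= N (heinz P b W t).
Proof.
pose h (x : R) := N (heinz P b W (2^-1 + x)).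
have h_even x : h (- x) = h x.
  rewrite /h -[RHS](mxnorm_sign b) -heinz_reflect.
  by have -> : 1 - (2^-1 + x) = 2^-1 - x by lra.
have h_midpoint x r : 2 * h x <= h (x + r) + h (x - r).
  apply: le_trans (mxnorm_mean_ge _ r) _; rewrite (heinz_midpoint exp_mxD).
  rewrite /h (addrA _ x r) (addrA _ x (- r)).
  exact: (mxnormD normN).
have hE (u : R) : u = 2^-1 + (u - 2^-1) by ring.
move=> st; rewrite (hE s) (hE t).
exact: (even_midpoint_convex_le h_midpoint h_even (mxnorm_heinz_bounded b W) st).
Qed.

Lemma hermitian_part_heinz b X t (c : R[i]) :
  hermitian_part (c *: heinz P b X t) =
  heinz P b (2^-1 *: (c *: X + ((-1) ^+ b * c^*) *: X ^t*)) t.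
Proof. exact: (heinz_hermitian_part exp_mx_adj). Qed.

Lemma num_radius_heinz_le b X s t : `|s - 2^-1| <= `|t - 2^-1| ->
  num_radius N (heinz P b X s) <= num_radius N (heinz P b X t).
Proof.
move=> st; apply: (num_radius_le normN) => theta.
have E u := congr1 N (hermitian_part_heinz b X u (expi theta)).
have eqW (a c : R) : a = c -> a <= c by move=> ->.
apply: le_trans (eqW _ _ (E s)) (le_trans _ (eqW _ _ (esym (E t)))).
exact: mxnorm_heinz_le.
Qed.

Lemma heinz_false X t :
  heinz P false X t = P t *m X *m P (1 - t) + P (1 - t) *m X *m P t.
Proof. by rewrite /heinz expr0 scale1r. Qed.

Lemma heinz_true X t :
  heinz P true X t = P t *m X *m P (1 - t) - P (1 - t) *m X *m P t.
Proof. by rewrite /heinz expr1 scaleN1r. Qed.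

Lemma heinz_false1 X : heinz P false X 1 = P 1 *m X + X *m P 1.
Proof. by rewrite heinz_false (subrr 1) exp_mx0 mulmx1 mul1mx. Qed.

Lemma heinz_true1 X : heinz P true X 1 = P 1 *m X - X *m P 1.
Proof. by rewrite heinz_true (subrr 1) exp_mx0 mulmx1 mul1mx. Qed.

End ExponentialGroup.

Section PosdefPowers.
Context {R : realType} {n : nat} (A : 'M[R[i]]_n).
Hypothesis posA : posdefmx A.

Lemma posdef_spectral :
  A = (spectralmx A) ^t* *m diag_mx (spectral_diag A) *m spectralmx A.
Proof.
rewrite -invmx_unitary ?spectral_unitarymx//.
exact/orthomx_spectralP/hermitian_normalmx/(proj1 posA).
Qed.

Lemma spectral_diag_gt0 i : 0 < spectral_diag A 0 i.
Proof.
apply: (posdef_diag_gt0 i (spectral_unitarymx A)).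
by rewrite -posdef_spectral.
Qed.

Definition log_spectrum (i : 'I_n) : R := ln (complex.Re (spectral_diag A 0 i)).

Lemma mxpowRE t : mxpowR A t = exp_mx (spectralmx A) log_spectrum t.
Proof.
rewrite /mxpowR /mxfun_calc /exp_mx (invmx_unitary (spectral_unitarymx A)).
suff -> : map_mx (fun z : R[i] => (complex.Re z `^ t)%:C) (spectral_diag A) =
    \row_i (expR (t * log_spectrum i))%:C by [].
apply/matrixP => i j; rewrite !mxE ord1 /powR gt_eqF//.
by have := spectral_diag_gt0 j; rewrite ltcE => /andP[].
Qed.

Lemma exp_log_spectrum : A = exp_mx (spectralmx A) log_spectrum 1.
Proof.
suff D1 : exp_diag log_spectrum 1 = diag_mx (spectral_diag A).
  by rewrite /exp_mx D1 -posdef_spectral.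
congr diag_mx; apply/matrixP => i j; rewrite mxE ord1 mul1r.
have := spectral_diag_gt0 j; rewrite ltcE /log_spectrum.
case: (spectral_diag A 0 j) => a b /= /andP[/eqP -> a0].
by rewrite lnK.
Qed.

End PosdefPowers.

Theorem mainTheorem7 (R : realType) (n : nat) (N : 'M[R[i]]_n -> R)
    (A X : 'M[R[i]]_n) (t : R) :
  is_mxnorm N -> unitarily_invariant N -> posdefmx A ->
  (0 <= t <= 1 ->
     num_radius N (mxpowR A t *m X *m mxpowR A (1 - t)
                   + mxpowR A (1 - t) *m X *m mxpowR A t)
       <= num_radius N (A *m X + X *m A)
  /\ num_radius N (mxpowR A t *m X *m mxpowR A (1 - t)
                   - mxpowR A (1 - t) *m X *m mxpowR A t)
       <= num_radius N (A *m X - X *m A))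
  /\
  (~~ (0 <= t <= 1) ->
     num_radius N (mxpowR A t *m X *m mxpowR A (1 - t)
                   + mxpowR A (1 - t) *m X *m mxpowR A t)
       >= num_radius N (A *m X + X *m A)
  /\ num_radius N (mxpowR A t *m X *m mxpowR A (1 - t)
                   - mxpowR A (1 - t) *m X *m mxpowR A t)
       >= num_radius N (A *m X - X *m A)).
Proof.
move=> normN unitN posA.
have uA := spectral_unitarymx A.
have := exp_log_spectrum posA.
rewrite !(mxpowRE posA); move: (log_spectrum A) => L.
move: (spectralmx A) uA => U uU ->.
have half : `|1 - 2^-1 : R| = 2^-1 by rewrite ger0_norm; lra.
have radius_le b s u (Y Z : 'M_n) :
    heinz (exp_mx U L) b X s = Y -> heinz (exp_mx U L) b X u = Z ->
    `|s - 2^-1| <= `|u - 2^-1| -> num_radius N Y <= num_radius N Z.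
  by move=> <- <-; exact: num_radius_heinz_le.
have Fp := heinz_false U L X t; have Fm := heinz_true U L X t.
have Gp := heinz_false1 L uU X; have Gm := heinz_true1 L uU X.
split=> [/andP[t0 t1]|tn].
  have tle : `|t - 2^-1| <= `|1 - 2^-1| by rewrite half ler_norml; lra.
  split; [exact: radius_le Fp Gp tle | exact: radius_le Fm Gm tle].
have tge : `|1 - 2^-1| <= `|t - 2^-1|.
  move: tn; rewrite half; apply: contraR; rewrite -ltNge ltr_norml; lra.
split; [exact: radius_le Gp Fp tge | exact: radius_le Gm Fm tge].
Qed.
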